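(* Let $\mathcal L$ be a Fregean logic with a protoconjunction $\wedge$. Then the parametrized equational translation $\tau(x,y)=\{x\wedge y\approx y\}$ almost defines truth in $\mathrm{Mod}^{*}\mathcal L$, i.e. for every $\langle\mathbf A,F\rangle\in\mathrm{Mod}^{*}\mathcal L$ with $F\neq\emptyset$, $F=\{a\in A: a\wedge^{\mathbf A}c=c\text{ for all }c\in A\}$.
   Context: Formulas are built over a countably infinite set of variables; $\mathbf{Fm}$ is the formula algebra. A logic $\mathcal L$ is a structural closure operator on sets of formulas; $\Gamma\vdash_{\mathcal L}\varphi$ means $\varphi$ is in the closure of $\Gamma$. $\mathcal L$ is Fregean if for every set of formulas $\Gamma$ the relation $\{\langle\varphi,\psi\rangle:\Gamma,\varphi\vdash_{\mathcal L}\psi\text{ and }\Gamma,\psi\vdash_{\mathcal L}\varphi\}$ is a congruence of $\mathbf{Fm}$. A protoconjunction is a binary term $\wedge$ with $\{x,y\}\vdash_{\mathcal L}x\wedge y$, $\{x,x\wedge y\}\vdash_{\mathcal L}y$ and $\{y,x\wedge y\}\vdash_{\mathcal L}x$. A deductive filter of $\mathcal L$ over $\mathbf A$ is $F\subseteq A$ such that $\Gamma\vdash_{\mathcal L}\varphi$ and $h[\Gamma]\subseteq F$ for a homomorphism $h\colon\mathbf{Fm}\to\mathbf A$ imply $h(\varphi)\in F$; $\mathcal{F}i_{\mathcal L}\mathbf A$ is the set of these. The Leibniz congruence $\Omega^{\mathbf A}F$ is the largest congruence of $\mathbf A$ compatible with $F$. $\mathrm{Mod}^{*}\mathcal L:=\{\langle\mathbf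 A,F\rangle:F\in\mathcal{F}i_{\mathcal L}\mathbf A,\ \Omega^{\mathbf A}F=\mathrm{Id}_{\mathbf A}\}$. *)

(* Defs.v *)
From mathcomp Require Import all_boot.
From mathcomp Require Import classical_sets.

Set Implicit Arguments.
Unset Strict Implicit.
Unset Printing Implicit Defensive.

Local Open Scope classical_set_scope.

(* Algebraic languages: an arbitrary type of finitary operation symbols. *)
Record signature := Signature {
  symbol :> Type;
  arity : symbol -> nat
}.

Record algebra (S : signature) := Algebra {
  carrier :> Type;
  interp : forall f : S, {ffun 'I_(arity f) -> carrier} -> carrier
}.

Definition homomorphism (S : signature) (A B : algebra S) (h : A -> B) : Prop :=
  forall (f : S) (a : {ffun 'I_(arity f) -> A}),
    h (interp a) = interp [ffun i => h (a i)].

Definition congruence (S : signature) (A : algebra S)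
    (theta : A -> A -> Prop) : Prop :=
  [/\ forall a, theta a a,
      forall a b, theta a b -> theta b a,
      forall a b c, theta a b -> theta b c -> theta a c &
      forall (f : S) (a b : {ffun 'I_(arity f) -> A}),
        (forall i, theta (a i) (b i)) -> theta (interp a) (interp b)].

Inductive term (S : signature) (X : Type) : Type :=
| Var of X
| App (f : S) of {ffun 'I_(arity f) -> term S X}.

Arguments Var S {X}.

Definition term_algebra (S : signature) (X : Type) : algebra S :=
  @Algebra S (term S X) (@App S X).

Fixpoint eval (S : signature) (X : Type) (A : algebra S) (v : X -> A)
    (t : term S X) {struct t} : A :=
  match t with
  | Var x => v x
  | App f ts => interp [ffun i => eval v (ts i)]
  end.

(* The formula algebra; nat serves as the countably infinite set of
   variables. *)
Definition Fm (S : signature) : algebra S := term_algebra S nat.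

(* Binary terms t(x, y) are the terms over a two-element set of variables:
   false stands for x and true for y. *)
Definition binary_term (S : signature) := term S bool.

Definition ap2 (S : signature) (A : algebra S) (t : binary_term S)
    (a b : A) : A :=
  eval (fun i : bool => if i then b else a) t.

Arguments ap2 {S} A t a b.

Record logic (S : signature) := Logic {
  closure : set (Fm S) -> set (Fm S);
  closure_ext : forall G, G `<=` closure G;
  closure_mono : forall G D, G `<=` D -> closure G `<=` closure D;
  closure_idem : forall G, closure (closure G) `<=` closure G;
  closure_struct : forall s : Fm S -> Fm S, homomorphism s ->
    forall G, s @` closure G `<=` closure (s @` G)
}.

Definition entails (S : signature) (L : logic S) (G : set (Fm S)) (p : Fm S)
  : Prop := closure L G p.

Definition fregean (S : signature) (L : logic S) : Prop :=
  forall G : set (Fm S),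
    congruence (fun p q : Fm S =>
      entails L (G `|` [set p]) q /\ entails L (G `|` [set q]) p).

Definition protoconjunction (S : signature) (L : logic S)
    (t : binary_term S) : Prop :=
  let x : Fm S := Var S 0 in
  let y : Fm S := Var S 1 in
  [/\ entails L [set x; y] (ap2 (Fm S) t x y),
      entails L [set x; ap2 (Fm S) t x y] y &
      entails L [set y; ap2 (Fm S) t x y] x].

Definition deductive_filter (S : signature) (L : logic S) (A : algebra S)
    (F : set A) : Prop :=
  forall (G : set (Fm S)) (p : Fm S), entails L G p ->
  forall h : Fm S -> A, homomorphism h -> h @` G `<=` F -> F (h p).

Definition compatible (S : signature) (A : algebra S) (F : set A)
    (theta : A -> A -> Prop) : Prop :=
  forall a b, theta a b -> F a -> F b.

Definition is_leibniz_congruence (S : signature) (A : algebra S) (F : set A)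
    (theta : A -> A -> Prop) : Prop :=
  [/\ congruence theta, compatible F theta &
      forall eta : A -> A -> Prop, congruence eta -> compatible F eta ->
        forall a b, eta a b -> theta a b].

Definition mod_star (S : signature) (L : logic S) (A : algebra S)
    (F : set A) : Prop :=
  deductive_filter L F /\ is_leibniz_congruence F (@eq A).

(* Parametrized equational translations tau(x, y) with one parameter y: sets
   of equations between binary terms, an equation being a pair of terms. *)
Definition translation (S : signature) :=
  set (binary_term S * binary_term S).

(* {x /\ y = y}, where t is the term x /\ y *)
Definition conj_translation (S : signature) (t : binary_term S) :
    translation S :=
  [set (t, Var S true)].

Definition almost_defines_truth (S : signature) (tau : translation S)
    (M : forall A : algebra S, set A -> Prop) : Prop :=
  forall (A : algebra S) (F : set A), M A F -> F !=set0 ->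
    F = [set a | forall (c : A) e, tau e -> ap2 A e.1 a c = ap2 A e.2 a c].

(* Main.v *)
Require Import Defs.
From mathcomp Require Import all_boot.
From mathcomp Require Import boolp classical_sets.

(** If [a] is in [F], then for every [c] the elements [a /\ c] and [c] are
    identified by the Leibniz congruence of [F]: over the premise [x], the
    formulas [x /\ y] and [y] are interderivable, so by the Fregean property
    they can be exchanged inside any formula.  Conversely, if [a /\ c = c] for
    some [c] in [F], then [a] is in [F] because [y, x /\ y |- x]. *)

Set Implicit Arguments.
Unset Strict Implicit.
Unset Printing Implicit Defensive.

Local Open Scope classical_set_scope.

(* The automatically generated principle has no induction hypothesis for the
   arguments nested in the finite function. *)
Fixpoint nested_term_ind (S : signature) (X : Type) (P : term S X -> Prop)
    (PVar : forall x, P (Var S x))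
    (PApp : forall f (ts : {ffun 'I_(arity f) -> term S X}),
      (forall i, P (ts i)) -> P (App ts))
    (u : term S X) : P u :=
  match u with
  | Var x => PVar x
  | App f ts => PApp f ts (fun i => nested_term_ind PVar PApp (ts i))
  end.

Section Evaluation.
Variables (S : signature) (X : Type).

Lemma eval_homomorphism (A : algebra S) (v : X -> A) :
  homomorphism (eval v : term_algebra S X -> A).
Proof. by []. Qed.

Lemma homomorphism_eval (A B : algebra S) (h : A -> B) (s : X -> A)
    (u : term S X) :
  homomorphism h -> h (eval s u) = eval (h \o s) u.
Proof.
move=> hh; elim/nested_term_ind: u => [//|f ts IH] /=.
by rewrite hh; congr interp; apply/ffunP => i; rewrite !ffunE IH.
Qed.

Lemma eval_congruence (A : algebra S) (theta : A -> A -> Prop) (s s' : X -> A)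
    (u : term S X) :
  congruence theta -> (forall x, theta (s x) (s' x)) ->
  theta (eval s u) (eval s' u).
Proof.
case=> _ _ _ theta_interp ss'; elim/nested_term_ind: u => [//|f ts IH] /=.
by apply: theta_interp => i; rewrite !ffunE.
Qed.

End Evaluation.

Lemma homomorphism_ap2 (S : signature) (A B : algebra S) (h : A -> B)
    (t : binary_term S) (a b : A) :
  homomorphism h -> h (ap2 A t a b) = ap2 B t (h a) (h b).
Proof.
move=> hh; rewrite /ap2 homomorphism_eval//; congr (eval _ t).
by apply/funext => -[].
Qed.

Definition update (A : Type) n (w : {ffun 'I_n -> A}) (i : 'I_n) (b : A) :=
  [ffun j => if j == i then b else w j].

(* The arguments are replaced one at a time, from left to right. *)
Lemma congruence_coordinatewise (S : signature) (A : algebra S)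
    (theta : A -> A -> Prop) :
  (forall a, theta a a) -> (forall a b, theta a b -> theta b a) ->
  (forall a b c, theta a b -> theta b c -> theta a c) ->
  (forall (f : S) (w : {ffun 'I_(arity f) -> A}) i b d, theta b d ->
     theta (interp (update w i b)) (interp (update w i d))) ->
  congruence theta.
Proof.
move=> refl sym trans upd; split=> // f a b ab.
pose mix k := [ffun i : 'I_(arity f) => if i < k then b i else a i].
have -> : b = mix (arity f) by apply/ffunP => i; rewrite ffunE ltn_ord.
have : arity f <= arity f by [].
(* Induction on the number of replaced arguments; the bound by [arity f] makes [k] itself an
   index. *)
elim: {1 3}(arity f) => [_|k IH lt_k].
  have -> : mix 0 = a by apply/ffunP => i; rewrite ffunE.
  exact: refl.
apply: trans (IH (ltnW lt_k)) _; pose i := Ordinal lt_k.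
have -> : mix k = update (mix k) i (a i).
  by apply/ffunP => j; rewrite !ffunE; case: eqP => // ->; rewrite ltnn.
have -> : mix k.+1 = update (mix k) i (b i).
  apply/ffunP => j; rewrite !ffunE; case: eqP => [->|/eqP ji].
    by rewrite ltnS leqnn.
  by rewrite ltnS leq_eqVlt -[_ == k]/(j == i) (negPf ji).
exact: upd.
Qed.

Section Indiscernibility.
Variables (S : signature) (A : algebra S) (F : set A).

Definition scons (b : A) (v : nat -> A) (n : nat) : A :=
  if n is m.+1 then v m else b.

(* The formulas with parameters from [A] play the role of the unary polynomial
   functions of [A]; the variable [0] is the argument. *)
Definition indiscernible (b d : A) : Prop :=
  forall (p : Fm S) (v : nat -> A),
    F (eval (scons b v) p) <-> F (eval (scons d v) p).

Lemma indiscernible_compatible : compatible F indiscernible.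
Proof. by move=> b d bd Fb; apply: (bd (Var S 0) (fun=> b)).1. Qed.

(* The hole of a formula [p] is filled with [f (y_1, .., x, .., y_n)], where
   the parameters of [p] are shifted by [arity f] to make room for the [y_j]. *)
Lemma indiscernible_update (f : S) (w : {ffun 'I_(arity f) -> A}) i b d :
  indiscernible b d ->
  indiscernible (interp (update w i b)) (interp (update w i d)).
Proof.
move=> bd p v.
pose s n : Fm S := if n is m.+1 then Var S (arity f + m).+1
  else App [ffun j : 'I_(arity f) => if j == i then Var S 0 else Var S j.+1].
(* Concatenation of [w] and [v]: each [y_j] takes the value [w j], and the shifted parameters keep
   theirs. *)
pose v' m := if insub m is Some j then w j else v (m - arity f).
have evE e : eval (scons (interp (update w i e)) v) p
    = eval (scons e v') (eval s p : Fm S).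
  rewrite (homomorphism_eval _ _ (eval_homomorphism _)); congr (eval _ p).
  apply/funext => -[|m] /=.
    congr interp; apply/ffunP => j; rewrite !ffunE.
    by case: eqP => //= _; rewrite /v' valK.
  by rewrite /v' insubF ?addKn// ltnNge leq_addr.
by rewrite !evE; apply: bd.
Qed.

Lemma indiscernible_congruence : congruence indiscernible.
Proof.
apply: congruence_coordinatewise => [a p v|a b ab p v|a b c ab bc p v|].
- by [].
- by split=> /ab.
- by split=> [/ab/bc|/bc/ab].
- exact: indiscernible_update.
Qed.

End Indiscernibility.

Section FregeanProtoconjunction.
Variables (S : signature) (L : logic S) (t : binary_term S).
Hypotheses (fregL : fregean L) (conjt : protoconjunction L t).
Variables (A : algebra S) (F : set A).
Hypothesis filterF : deductive_filter L F.

Lemma filter_entails2 (p q r : Fm S) (v : nat -> A) :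
  entails L [set p; q] r -> F (eval v p) -> F (eval v q) -> F (eval v r).
Proof.
move=> pqr Fp Fq.
apply: (filterF pqr (eval_homomorphism (v : nat -> A))).
by move=> _ [_ [->|->] <-].
Qed.

Lemma filter_protoconjunction_left (a c : A) :
  F c -> F (ap2 A t a c) -> F a.
Proof.
case: conjt => _ _ yxy Fc Fac.
apply: (filter_entails2 (v := scons a (fun=> c)) yxy) => //.
by rewrite (homomorphism_ap2 _ _ _ (eval_homomorphism _)).
Qed.

Lemma indiscernible_protoconjunction (a c : A) :
  F a -> indiscernible F (ap2 A t a c) c.
Proof.
move=> Fa p v; case: conjt => xy xxy _.
pose x : Fm S := Var S 0; pose y : Fm S := Var S 1.
(* Variables [0] and [1] are reserved for [a] and [c], so [s q] fills the hole of [p] with [q] and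
   shifts the parameters past both. *)
pose h := scons a (scons c v).
pose s (q : Fm S) n : Fm S := if n is m.+1 then Var S m.+2 else q.
have sE q : eval h (eval (s q) p : Fm S) = eval (scons (eval h q) v) p.
  rewrite (homomorphism_eval _ _ (eval_homomorphism _)); congr (eval _ p).
  by apply/funext => -[].
have [pq qp] : let q := eval (s (ap2 (Fm S) t x y)) p in
    let r := eval (s y) p in entails L [set x; q] r /\ entails L [set x; r] q.
  (* The two substitutions differ only at the hole, where the first two protoconjunction rules give
     the interderivability over [x]. *)
  apply: (eval_congruence _ (fregL [set x])) => -[//|n] /=.
  by case: (fregL [set x]) => refl _ _ _; apply: refl.
have conjE : eval h (ap2 (Fm S) t x y) = ap2 A t a c.
  by rewrite (homomorphism_ap2 _ _ _ (eval_homomorphism _)).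
rewrite -conjE -sE -[eval (scons c v) p]/(eval (scons (eval h y) v) p) -sE.
by split=> Fu; [apply: (filter_entails2 pq) | apply: (filter_entails2 qp)].
Qed.

End FregeanProtoconjunction.

Theorem theorem4p9 (S : signature) (L : logic S) (t : binary_term S)
  (fregL : fregean L) (conjt : protoconjunction L t) :
  almost_defines_truth (conj_translation t) (mod_star L).
Proof.
move=> A F [filterF [_ _ maxF]] [c0 Fc0]; apply/seteqP; split=> a.
  (* In a reduced matrix the Leibniz congruence is equality, so by its maximality indiscernible
     elements are equal. *)
  move=> Fa c _ -> /=; apply: (maxF (indiscernible F)).
  - exact: indiscernible_congruence.
  - exact: indiscernible_compatible.
  - exact: indiscernible_protoconjunction.
(* Nonemptiness of [F] supplies the parameter [c0]. *)
move=> /(_ c0 _ erefl) /= ac0.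
by apply: (filter_protoconjunction_left conjt filterF Fc0); rewrite ac0.
Qed.
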